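(* For $\epsilon>0$ let $(X,\mu,x)$ and $(Y,\nu,y)$ be pointed metric measure spaces with $$d_*((X,\mu,x),(Y,\nu,y))<\epsilon.$$ There exist compact $$x\in K_\mu\subset\operatorname{spt}\mu\cap B(x,1/\epsilon)\quad\text{and}\quad y\in K_\nu\subset\operatorname{spt}\nu\cap B(y,1/\epsilon)\qquad(\mathrm{a})$$ such that $$\max\{\mu(B(x,1/\epsilon)\setminus K_\mu),\ \nu(B(y,1/\epsilon)\setminus K_\nu)\}<\epsilon\qquad(\mathrm{b})$$ and $$d_{pmGH}\big((K_\mu,\mu|_{K_\mu},x),(K_\nu,\nu|_{K_\nu},y)\big)<3\epsilon.\qquad(\mathrm{c})$$ Conversely, if there exist compact $K_\mu,K_\nu$ as in (a) satisfying (b) and $$d_*\big((K_\mu,\mu|_{K_\mu},x),(K_\nu,\nu|_{K_\nu},y)\big)<\epsilon,$$ then $$d_*((X,\mu,x),(Y,\nu,y))<3\epsilon.$$ That is, $d_*$ is bi-Lipschitz equivalent to the metric defined by taking the infimum over all $0<\epsilon<1/2$ for which (b) and (c) hold (for some compact $K_\mu,K_\nu$ as in (a)).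
   Context: $B(x,r)$ is the closed ball. $\mathcal{M}_{loc}(X)$ is the set of Borel regular measures on $X$ that are finite on all balls, and $\operatorname{spt}\mu$ is the smallest closed set whose complement has $\mu$-measure zero. A pointed metric measure space $(X,\mu,x)$ consists of a complete and separable metric space $X$, a distinguished point $x\in X$ and a $\mu\in\mathcal{M}_{loc}(X)$. For a metric space $Z$ and $z\in Z$: - for $A,B\subset Z$, $H_z(A,B)$ is the infimum of all $0<\epsilon<1/2$ such that every point of $A\cap B(z,1/\epsilon)$ is at distance at most $\epsilon$ from $B$ and every point of $B\cap B(z,1/\epsilon)$ is at distance at most $\epsilon$ from $A$ (and $1/2$ if no such $\epsilon$ exists); - for $\mu,\nu\in\mathcal{M}_{loc}(Z)$ and $L,r>0$, $F_z^{L,r}(\mu,\nu)=\sup\{\int g\,d(\mu-\nu): g\colon Z\to[-1,1]\ L\text{-Lipschitz},\ \operatorname{spt}g\subset B(z,r)\}$, where $\operatorname{spt} g$ is the closure of $\{g\neq 0\}$, and $F_z(\mu,\nu)$ is the infimum of all $0<\epsilon<1/2$ with $F_z^{1/\epsilon,1/\epsilon}(\mu,\nu)<\epsilon$ (and $1/2$ if no such $\epsilon$ exists). For pointed metric measure spaces, $d_{pmGH}((X,\mu,x),(Y,\nu,y))$ (respectively $d_*((X,\mu,x),(Y,\nu,y))$) is the infimum of $H_z(X,Y)+F_z(\mu,\nu)$ (respectively of $F_z(\mu,\nu)$) over all pointed metric spaces $(Z,z)$ and all isometric embeddings of $X$ and $Y$ into $Z$ mapping $x$ and $y$ to $z$,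 where spaces and measures are identified with their images in $Z$.
   Formalization: In (a), spt μ and spt ν are replaced by spt μ ∪ {x} and spt ν ∪ {y}, since otherwise no K exists when x or y lies outside the support (e.g. μ=ν=0); the final infimum is only shown comparable to d_*, not a metric, as its triangle inequality can fail. *)

(* Defs.v *)
From HB Require Import structures.
From mathcomp Require Import all_boot all_order all_algebra.
From mathcomp Require Import all_classical all_reals all_analysis.
Set Implicit Arguments.
Unset Strict Implicit.
Unset Printing Implicit Defensive.
Import Order.TTheory GRing.Theory Num.Theory.
Import numFieldNormedType.Exports.
Local Open Scope classical_set_scope.
Local Open Scope ring_scope.

(* The distinguished point of a pointed metric space is [point]. *)
#[short(type="pmetricType")]
HB.structure Definition PointedMetric (R : numDomainType) :=
  { M of Metric R M & Pointed M }.

Notation borel T := (g_sigma_algebraType (@open T)).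

Section Basics.
Context {R : realType}.

(* The library's [closed_ball] is the closure of the open ball, which can be
   strictly smaller. *)
Definition cball (T : metricType R) (x : T) (r : R) : set T :=
  [set y | mdist x y <= r].

Definition separable (T : topologicalType) : Prop :=
  exists2 D : set T, countable D & dense D.

Definition complete (T : puniformType) : Prop :=
  forall F : set_system T, ProperFilter F -> cauchy F -> cvg F.

Definition spt (T : pmetricType R) (mu : set T -> \bar R) : set T :=
  \bigcap_(C in [set C | closed C /\ mu (~` C) = 0%E]) C.

(* The infimum of all 0 < e < 1/2 satisfying P, and 1/2 if there are none. *)
Definition inf_half (P : R -> Prop) : R :=
  let E := [set e | 0 < e < 2^-1 /\ P e] in
  if `[< E !=set0 >] then inf E else 2^-1.

Definition Hdist (Z : metricType R) (z : Z) (A B : set Z) : R :=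
  inf_half (fun e =>
    (forall a, (A `&` cball z e^-1) a -> (edist_inf B a <= e%:E)%E) /\
    (forall b, (B `&` cball z e^-1) b -> (edist_inf A b <= e%:E)%E)).

Definition test_functions (Z : metricType R) (z : Z) (L r : R) : set (Z -> R) :=
  [set g | [/\ forall p, -1 <= g p <= 1,
              forall p q, `|g p - g q| <= L * mdist p q
            & closure [set p | g p != 0] `<=` cball z r]].

(* For measures finite on balls both integrals are finite, so that the
   difference below is the integral of g against mu - nu. *)
Definition FLr (Z : pmetricType R) (z : Z) (mu nu : set (borel Z) -> \bar R)
    (L r : R) : \bar R :=
  ereal_sup [set (\int[mu]_p (g p)%:E - \int[nu]_p (g p)%:E)%E
            | g in test_functions z L r].

Definition Fdist (Z : pmetricType R) (z : Z)
    (mu nu : set (borel Z) -> \bar R) : R :=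
  inf_half (fun e => (FLr z mu nu e^-1 e^-1 < e%:E)%E).

Definition pointed_isometry (X Z : pmetricType R) (f : X -> Z) : Prop :=
  f point = point /\ forall p q, mdist (f p) (f q) = mdist p q.

End Basics.

(* A measure of M_loc(X) is represented by its values on the Borel sets, which
   determine a Borel regular outer measure. *)
Record pmms (R : realType) := Pmms {
  pmms_sort :> pmetricType R;
  pmms_complete : complete pmms_sort;
  pmms_separable : separable pmms_sort;
  pmms_measure : {measure set (borel pmms_sort) -> \bar R};
  pmms_locfin : forall (x : pmms_sort) (r : R),
    (pmms_measure (cball x r) < +oo)%E
}.

Section Distances.
Context {R : realType}.

Local Notation push mu f := (pushforward (T1 := borel _) (T2 := borel _) mu f).

Definition d_pmGH (X Y : pmms R) : R :=
  inf [set d | exists (Z : pmetricType R) (f : X -> Z) (g : Y -> Z),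
    [/\ pointed_isometry f, pointed_isometry g
      & d = Hdist point (range f) (range g)
            + Fdist point (push (pmms_measure X) f) (push (pmms_measure Y) g)]].

Definition d_star (X Y : pmms R) : R :=
  inf [set d | exists (Z : pmetricType R) (f : X -> Z) (g : Y -> Z),
    [/\ pointed_isometry f, pointed_isometry g
      & d = Fdist point (push (pmms_measure X) f) (push (pmms_measure Y) g)]].

End Distances.

Section Subtype_metric.
Context {R : realType} {X : metricType R} (A : set X).

Let sdist (x y : A) : R := mdist (set_val x) (set_val y).

Let sdist_ge0 x y : 0 <= sdist x y.
Proof. exact: mdist_ge0. Qed.

Let sdist_positivity x y : sdist x y = 0 -> x = y.
Proof. by move=> /mdist_positivity; rewrite !set_valE => /val_inj. Qed.

Let sballE (x : A) (d : R) : ball x d = [set y | sdist x y < d].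
Proof.
rewrite -(@initial_ballE R (A : Type) X set_val d x).
by rewrite ballEmdist.
Qed.

HB.instance Definition _ := @PseudoMetric_isMetric.Build R (A : Type)
  sdist sdist_ge0 sdist_positivity sballE.

End Subtype_metric.

(* The subspace K of X, pointed at x. *)
Definition pointed_sub {T : Type} (K : set T) (x : T) (Kx : K x) : Type :=
  set_type K.

Section Pointed_sub.
Context {R : realType} {X : pmetricType R} {K : set X} {x : X} (Kx : K x).

HB.instance Definition _ := Metric.copy (pointed_sub Kx) (set_type K).
HB.instance Definition _ := isPointed.Build (pointed_sub Kx)
  (exist _ x (mem_set Kx)).

Lemma compact_pointed_sub : compact K -> compact [set: pointed_sub Kx].
Proof.
move=> cK F PF _.
have PG : ProperFilter (set_val @ (F : set_system (set_type K))) by apply: fmap_proper_filter.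
have GK : (set_val @ (F : set_system (set_type K))) K.
  by apply: (@filterS _ F _ setT) => [p _|]; [exact: set_valP|exact: filterT].
have [p [Kp clp]] := cK _ PG GK.
exists (exist _ p (mem_set Kp)); split => // U V FU /nbhs_ballP[r /= r0 rV].
have GU : (set_val @ (F : set_system (set_type K))) (set_val @` U).
  by apply: (@filterS _ F _ U) => // u Uu; exists u.
have pr : nbhs p (ball p r) by apply/nbhs_ballP; exists r.
have [q [[u Uu uq] pq]] := clp _ _ GU pr.
exists u; split => //; apply: rV.
by rewrite /ball/=/initial_ball uq.
Qed.

Lemma complete_pointed_sub : compact K -> complete (pointed_sub Kx).
Proof.
move=> /compact_pointed_sub cK F PF cF.
by apply: (@compact_cauchy_cvg _ [set: pointed_sub Kx]) => //; exact: filterT.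
Qed.

Lemma separable_pointed_sub : compact K -> separable (pointed_sub Kx).
Proof.
move=> /compact_pointed_sub /compact_second_countable[B cB [oB bB]].
exists ((fun U => get U) @` (B `&` [set U | U !=set0])).
  apply: (sub_countable (card_image_le _ _)).
  by apply: sub_countable cB; apply: subset_card_le; exact: subIsetl.
move=> O [p Op] oO.
have [U [BU Up] UO] : filter_from [set U | B U /\ U p] id O.
  by apply: bB; exact: open_nbhs_nbhs.
exists (get U); split; first by apply: UO; apply: getPex; exists p.
by exists U => //; split => //; exists p.
Qed.

Lemma closed_compact : compact K -> closed K.
Proof. by apply: compact_closed; exact: metric_hausdorff. Qed.

Lemma measurable_sub_image (A : set (borel (pointed_sub Kx))) :
  compact K -> measurable A ->
  measurable (set_val @` (A : set (set_type K)) : set (borel X)).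
Proof.
move=> /closed_compact clK mA.
have mK : measurable (K : set (borel X)).
  by rewrite -(setCK K); apply: measurableC; apply: sub_sigma_algebra; exact: closed_openC.
pose G := [set B : set (set_type K) | measurable (set_val @` B : set (borel X))].
suff : <<s @open (pointed_sub Kx) >> `<=` G by exact.
apply: smallest_sub => //; first split.
- by rewrite /G/= image_set0; exact: measurable0.
- move=> B GB; rewrite /G/=.
  suff -> : set_val @` (setT `\` B) = K `\` set_val @` B by exact: measurableD.
  apply/seteqP; split => [_ [p [_ Bp] <-]|p [Kp Bp]].
    split; first exact: set_valP.
    by move=> [q Bq /val_inj qp]; apply: Bp; rewrite -qp.
  exists (exist _ p (mem_set Kp)) => //; split => // Bp'; apply: Bp.
  by exists (exist _ p (mem_set Kp)).
- move=> F GF; rewrite /G/= image_bigcup; exact: bigcupT_measurable.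
- move=> B [C oC <-]; rewrite /G/=.
  suff -> : set_val @` (set_val @^-1` C : set (set_type K)) = K `&` C.
    by apply: measurableI => //; exact: sub_sigma_algebra.
  apply/seteqP; split => [_ [p Cp <-]|p [Kp Cp]].
    by split => //; exact: set_valP.
  by exists (exist _ p (mem_set Kp)).
Qed.

End Pointed_sub.

Section Restriction.
Context {R : realType} {X : pmms R} {K : set X} {x : X}.
Variables (cK : compact K) (Kx : K x).

Definition restr_measure (A : set (borel (pointed_sub Kx))) : \bar R :=
  pmms_measure X (set_val @` (A : set (set_type K))).

Let restr_measure0 : restr_measure set0 = 0%E.
Proof. by rewrite /restr_measure image_set0 measure0. Qed.

Let restr_measure_ge0 A : (0 <= restr_measure A)%E.
Proof. exact: measure_ge0. Qed.

Let restr_measure_semi_sigma_additive : semi_sigma_additive restr_measure.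
Proof.
move=> F mF tF mUF; rewrite /restr_measure image_bigcup.
apply: measure_semi_sigma_additive.
- by move=> n; exact: measurable_sub_image.
- apply/trivIsetP => i j _ _ ij; rewrite -subset0 => _ [[p Fp <-] [q Fq]].
  move=> /val_inj qp; move: Fq; rewrite qp => Fq.
  by move/trivIsetP : tF => /(_ i j I I ij); rewrite -subset0 => /(_ p); apply.
- rewrite -image_bigcup; exact: (measurable_sub_image cK mUF).
Qed.

HB.instance Definition _ := isMeasure.Build _ _ _ restr_measure
  restr_measure0 restr_measure_ge0 restr_measure_semi_sigma_additive.

Lemma restr_measure_locfin (p : pointed_sub Kx) (r : R) :
  (restr_measure (cball p r) < +oo)%E.
Proof.
apply: le_lt_trans (pmms_locfin (set_val p) r).
have mcball (T : metricType R) (z : T) : open (~` cball z r).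
  rewrite openE => q /negP; rewrite -ltNge => zq.
  apply/nbhs_ballP; exists (mdist z q - r); rewrite /= ?subr_gt0// => w.
  rewrite ballEmdist/= => qw; apply/negP; rewrite -ltNge.
  have := metric_triangle z w q; rewrite (metric_sym w q) => zwq.
  by move: qw; rewrite ltrBrDl -ltrBrDr => /lt_le_trans; apply; rewrite lerBlDr.
have mB (T : pmetricType R) (z : T) : measurable (cball z r : set (borel T)).
  rewrite -(setCK (cball z r)); apply: measurableC.
  by apply: sub_sigma_algebra; exact: mcball.
apply: le_measure.
- by apply/mem_set; exact: (measurable_sub_image cK (mB _ p)).
- by apply/mem_set; exact: mB.
- by move=> _ [q pq <-].
Qed.

(* (K, mu|_K, x) as a pointed metric measure space. *)
Definition restr : pmms R :=
  Pmms (complete_pointed_sub (Kx := Kx) cK) (separable_pointed_sub Kx cK)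
    restr_measure_locfin.

End Restriction.

Section Compact_approximation.
Context {R : realType}.

(* If the base point lies in spt mu, the union with [set point] below is spt mu;
   if not, no set both contains the base point and is contained in spt mu. *)
Definition supported_in_ball (e : R) (X : pmms R) (K : set X) : Prop :=
  K `<=` (spt (pmms_measure X) `|` [set point]) `&` cball point e^-1.

Definition small_complements (e : R) (X Y : pmms R) (K : set X) (L : set Y) : Prop :=
  (maxe (pmms_measure X (cball point e^-1 `\` K))
        (pmms_measure Y (cball point e^-1 `\` L)) < e%:E)%E.

Definition d_compact (X Y : pmms R) : R :=
  inf_half (fun e =>
    exists (K : set X) (cK : compact K) (xK : K point)
           (L : set Y) (cL : compact L) (yL : L point),
      [/\ supported_in_ball e K, supported_in_ball e L, small_complements e K L
        & d_pmGH (restr cK xK) (restr cL yL) < 3 * e]).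

End Compact_approximation.

(* Main.v *)
(** If the measures are d-close for test functions at scale d < e, then the part
of mu in B(x,1/e) at distance at least d from spt nu has mass less than d: test
with a 1/d-Lipschitz function which is 1 there and 0 on spt nu. K_mu consists of
a compact subset of the rest, of almost full mass, together with the base point
and a finite net making the two compact sets close to each other.

The test functions g for mu|K_mu - nu|K_nu at scale e are handled without losing
the discarded mass: K_mu is at distance at least d from the discarded part of
nu, and K_nu from that of mu. So some 1/d-Lipschitz function is at least g on
K_mu, at most g on K_nu, nonnegative on the discarded part of mu, nonpositive on
that of nu, and zero outside B(x,1/e). Integrating it against mu - nu bounds the
integral of g, up to the small loss of the compact approximation, so the
F-distance is at most e, and H is at most 2d.

Conversely, a space containing K_mu and K_nu is extended by amalgamation to one
containing X and Y, and restricting the measures costs less than e for each. *)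
Require Import Defs.
From HB Require Import structures.
From mathcomp Require Import all_boot all_order all_algebra.
From mathcomp Require Import all_classical all_reals all_analysis.
From mathcomp Require Import finmap measurable_realfun lra.
Set Implicit Arguments.
Unset Strict Implicit.
Unset Printing Implicit Defensive.
Import Order.TTheory GRing.Theory Num.Theory.
Import numFieldNormedType.Exports.
Local Open Scope classical_set_scope.
Local Open Scope ring_scope.

(** * Turning a pseudometric into a metric space *)

Section Metric_identification.
Context {R : realType} {W : Type} (w0 : W) (rho : W -> W -> R).
Hypotheses (rho0 : forall x, rho x x = 0)
  (rhoC : forall x y, rho x y = rho y x)
  (rhoD : forall x y z, rho x z <= rho x y + rho y z).

Let rho_eq x y : rho x y = 0 -> rho x = rho y.
Proof.
move=> xy; apply/funext => z; apply/eqP; rewrite eq_le.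
by have := rhoD x y z; have := rhoD y x z; rewrite (rhoC y x) xy !add0r => -> ->.
Qed.

(* The point w is identified with its distance function [rho w]. *)
Let quotient : Type := set_type (range rho).

Let repr (s : quotient) : W := sval (cid2 (set_valP s)).

Let reprK (s : quotient) : rho (repr s) = set_val s.
Proof. by rewrite /repr; case: cid2. Qed.

Let qdist (s t : quotient) : R := rho (repr s) (repr t).

Let qdistxx s : qdist s s = 0. Proof. exact: rho0. Qed.

Let qdist_positivity s t : qdist s t = 0 -> s = t.
Proof. by move=> /rho_eq; rewrite !reprK !set_valE => /val_inj. Qed.

Let qdistC s t : qdist s t = qdist t s. Proof. exact: rhoC. Qed.

Let qdistD t s u : qdist s u <= qdist s t + qdist t u. Proof. exact: rhoD. Qed.

Let proj w : quotient :=
  exist _ (rho w) (mem_set (ex_intro2 _ _ w I erefl : range rho (rho w))).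

HB.instance Definition _ := Choice.on quotient.
HB.instance Definition _ := @isMetric.Build R quotient qdist
  qdistxx qdist_positivity qdistC qdistD.
HB.instance Definition _ := isPointed.Build quotient (proj w0).

Lemma metric_identification : exists (M : pmetricType R) (h : W -> M),
  h w0 = point /\ forall v w, mdist (h v) (h w) = rho v w.
Proof.
exists quotient, proj; split=> // v w.
transitivity (rho (repr (proj v)) (repr (proj w))); first by [].
(* The representative of the class of [v] may differ from [v], but it has the same distance
   function, so it can be replaced in one argument at a time. *)
by rewrite (reprK (proj v)) [LHS]rhoC (reprK (proj w)) [RHS]rhoC.
Qed.

End Metric_identification.

(** * Gluing two metric spaces along a common subspace *)

Section Amalgam.
Context {R : realType} {A B C : pmetricType R}.
Variables (i : C -> A) (j : C -> B).
Hypotheses (ii : pointed_isometry i) (ij : pointed_isometry j).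

(** Lengths of the paths from [a] to [b] that cross once, at a point of the common part [C]; their
    infimum [c] is the distance between the two sides of the gluing. *)
Let S a b : set R := [set mdist a (i k) + mdist (j k) b | k in setT].

Let c a b : R := inf (S a b).

Let S_lb a b : has_inf (S a b).
Proof.
split; first by exists (mdist a (i point) + mdist (j point) b), point.
by exists 0 => _ [k _ <-]; rewrite addr_ge0// mdist_ge0.
Qed.

Let c_le a b k : c a b <= mdist a (i k) + mdist (j k) b.
Proof. by apply: ge_inf; [have [] := S_lb a b|exists k]. Qed.

Let le_c a b (r : R) :
  (forall k, r <= mdist a (i k) + mdist (j k) b) -> r <= c a b.
Proof.
by move=> h; apply: lb_le_inf; [have [] := S_lb a b|move=> _ [k _ <-]].
Qed.

Let rho (x y : A + B) : R := match x, y with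
  | inl a, inl a' => mdist a a'
  | inr b, inr b' => mdist b b'
  | inl a, inr b => c a b
  | inr b, inl a => c a b
  end.

(** A detour through [B] enters at some [k] and leaves at some [k']. Its part in [B] is at least the
    distance from [j k] to [j k'], which is that from [i k] to [i k'], so it is no shortcut. *)
Let rho_ABA a b a' : mdist a a' <= c a b + c a' b.
Proof.
rewrite -lerBlDr; apply: le_c => k; rewrite lerBlDr addrC -lerBlDr.
apply: le_c => k'.
have := metric_triangle a (i k) a'; have := metric_triangle (i k) (i k') a'.
have := metric_triangle (j k) b (j k').
rewrite (proj2 ii) (proj2 ij) (metric_sym b) (metric_sym (i k') a').
lra.
Qed.

Let rho_BAB b a b' : mdist b b' <= c a b + c a b'.
Proof.
rewrite -lerBlDr; apply: le_c => k; rewrite lerBlDr addrC -lerBlDr.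
apply: le_c => k'.
have := metric_triangle b (j k) b'; have := metric_triangle (j k) (j k') b'.
have := metric_triangle (i k) a (i k').
rewrite (proj2 ii) (proj2 ij) (metric_sym (i k) a) (metric_sym b (j k)).
lra.
Qed.

Let rho_AAB a a' b : c a b <= mdist a a' + c a' b.
Proof.
rewrite addrC -lerBlDr; apply: le_c => k; rewrite lerBlDr.
have := c_le a b k; have := metric_triangle a a' (i k); lra.
Qed.

Let rho_ABB a b b' : c a b <= c a b' + mdist b b'.
Proof.
rewrite -lerBlDr; apply: le_c => k; rewrite lerBlDr.
have := c_le a b k; have := metric_triangle (j k) b' b.
rewrite (metric_sym b' b); lra.
Qed.

Let rho0 x : rho x x = 0.
Proof. by case: x => x; exact: mdistxx. Qed.

Let rhoC x y : rho x y = rho y x.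
Proof. by case: x y => [x|x] [y|y] //; exact: metric_sym. Qed.

Let rhoD x y z : rho x z <= rho x y + rho y z.
Proof.
case: x y z => [x|x] [y|y] [z|z] /=; try exact: metric_triangle.
- exact: rho_AAB.
- exact: rho_ABA.
- by rewrite (metric_sym y z); exact: rho_ABB.
- by rewrite (metric_sym y z) addrC; exact: rho_AAB.
- exact: rho_BAB.
- by rewrite addrC; exact: rho_ABB.
Qed.

Lemma amalgam : exists (Z : pmetricType R) (f : A -> Z) (g : B -> Z),
  [/\ pointed_isometry f, pointed_isometry g & forall k, f (i k) = g (j k)].
Proof.
have [Z [h [h0 hE]]] := metric_identification (inl point) rho0 rhoC rhoD.
have hij k : h (inl (i k)) = h (inr (j k)).
  apply: mdist_positivity; rewrite hE /=; apply/eqP.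
  rewrite eq_le (le_trans (c_le _ _ k)) ?mdistxx ?addr0//=.
  by apply: le_c => k'; rewrite addr_ge0// mdist_ge0.
exists Z, (h \o inl), (h \o inr); split => //; split => //=.
by rewrite -(proj1 ij) -hij (proj1 ii).
Qed.

End Amalgam.

(** Gluing at the base points alone. This makes the sets of values in [d_star] and [d_pmGH]
    nonempty, so that [inf] there is a true infimum. *)
Lemma wedge {R : realType} (A B : pmetricType R) :
  exists (Z : pmetricType R) (f : A -> Z) (g : B -> Z),
    pointed_isometry f /\ pointed_isometry g.
Proof.
have pK : [set point] (point : A) by [].
have valE (p : pointed_sub pK) : set_val p = point by exact: (set_valP p).
have [||Z [f [g [If Ig _]]]] := @amalgam R A B (pointed_sub pK) set_val (cst point).
- by split.
- split => // p q; rewrite mdistxx.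
  by rewrite [RHS](_ : _ = mdist (set_val p) (set_val q))// !valE mdistxx.
- by exists Z, f, g.
Qed.

(** * Borel sets, separability and compactness in metric spaces *)

Section Metric_topology.
Context {R : realType}.

Lemma closed_cball (T : metricType R) (z : T) (r : R) : closed (cball z r).
Proof.
rewrite -openC openE => q /negP; rewrite -ltNge => zq.
apply/nbhs_ballP; exists (mdist z q - r); rewrite /= ?subr_gt0// => w.
rewrite ballEmdist/= => qw; apply/negP; rewrite -ltNge.
have := metric_triangle z w q; rewrite (metric_sym w q); lra.
Qed.

Lemma open_mball (T : metricType R) (z : T) (r : R) : open (ball z r).
Proof.
rewrite openE => q; rewrite ballEmdist/= => zq.
apply/nbhs_ballP; exists (r - mdist z q); rewrite /= ?subr_gt0// => w.
rewrite !ballEmdist/=; have := metric_triangle z q w; lra.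
Qed.

Lemma borel_closed (T : ptopologicalType) (A : set T) :
  closed A -> measurable (A : set (borel T)).
Proof.
move=> cA; rewrite -(setCK A); apply: measurableC.
by apply: sub_sigma_algebra; exact: closed_openC.
Qed.

Lemma continuous_borel (T U : ptopologicalType) (f : T -> U) :
  continuous f -> measurable_fun setT (f : borel T -> borel U).
Proof.
move=> /continuousP cf.
apply: (@measurability _ _ (borel T) (borel U) _ _ (@open U)) => //.
move=> _ [B oB <-]; rewrite setTI.
by apply: sub_sigma_algebra; exact: cf.
Qed.

Lemma pointed_isometry_measurable (X Z : pmetricType R) (f : X -> Z) :
  pointed_isometry f -> measurable_fun setT (f : borel X -> borel Z).
Proof.
move=> [_ fI]; apply: continuous_borel => p.
apply/cvg_ballP => e e0; apply/nbhs_ballP; exists e => //= q.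
by rewrite !ballEmdist /= fI.
Qed.

Lemma lipschitz_continuous (X : pmetricType R) (g : X -> R) (L : R) :
  (forall p q, `|g p - g q| <= L * mdist p q) -> continuous g.
Proof.
move=> gL p; apply/cvgrPdist_lt => e e0.
have L0 : 0 < `|L| + 1 by rewrite ltr_pwDr.
apply/nbhs_ballP; exists (e / (`|L| + 1)); rewrite /= ?divr_gt0// => q.
rewrite ballEmdist/= ltr_pdivlMr// => pq; apply: le_lt_trans (gL p q) _.
apply: le_lt_trans pq; rewrite mulrC ler_wpM2l ?mdist_ge0//.
by rewrite (le_trans (ler_norm L))// lerDl.
Qed.

Lemma continuous_borel_real (X : pmetricType R) (g : X -> R) :
  continuous g -> measurable_fun setT (g : borel X -> R).
Proof.
move=> /continuousP cg; apply: (measurability _ (RGenOpens.measurableE R)).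
move=> _ [_ [a [b ->] <-]]; rewrite setTI.
by apply: sub_sigma_algebra; apply: cg; exact: interval_open.
Qed.

Lemma separable_dense_seq (X : pmetricType R) : separable X ->
  exists d : nat -> X, forall (p : X) (e : R), 0 < e -> exists n, mdist (d n) p < e.
Proof.
move=> [D /countable_injP[f fi] dD].
(* A number that codes no element of [D] gives the base point; only the values at the codes [f q]
   matter. *)
exists (fun n => xget point [set x | D x /\ f x = n]) => p e e0.
have [||q [pq Dq]] := dD (ball p e).
- by exists p; exact: ballxx.
- exact: open_mball.
exists (f q).
suff -> : xget point [set x | D x /\ f x = f q] = q.
  by move: pq; rewrite ballEmdist/= metric_sym.
case: xgetP => [y _ [Dy]|/(_ q)[]//].
by apply: fi; exact: mem_set.
Qed.

Lemma ultra_bigcup {T} (F : set_system T) (UF : UltraFilter F) (A : nat -> set T) n :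
  F (\bigcup_(i < n) A i) -> exists i, F (A i).
Proof.
elim: n => [|n IH] FA.
  by exfalso; apply: (@filter_not_empty _ F _); move: FA; rewrite bigcup_mkord big_ord0.
have [?|FC] := in_ultra_setVsetC (A n) UF; first by exists n.
apply: IH; apply: filterS (filterI FA FC) => x [[i /= iSn Aix] nAn].
exists i => //=; move: iSn; rewrite ltnS leq_eqVlt => /orP[/eqP ni|//].
by rewrite ni in Aix.
Qed.

(** At each scale an ultrafilter containing [K] contains one ball of a finite cover, so it is
    Cauchy; its limit lies in [K] because [K] is closed. *)
Lemma totally_bounded_compact (X : pmetricType R) (K : set X) :
  complete X -> closed K ->
  (forall e : R, 0 < e -> exists (d : nat -> X) (n : nat),
     K `<=` \bigcup_(i < n) cball (d i) e) ->
  compact K.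
Proof.
move=> cX clK tbK; rewrite compact_ultra => F UF FK.
have /cX : cauchy F.
  apply: cauchy_exP => e e0; have [d [n Kd]] := tbK _ (divr_gt0 e0 (ltr0n _ 2)).
  have [i Fi] := ultra_bigcup UF (filterS Kd FK).
  exists (d i); apply: filterS Fi => q; rewrite ballEmdist /cball /=; lra.
move=> /cvg_ex[p Fp]; exists p; split => //; apply: clK => U pU.
have FU : F U by exact: Fp.
exact: (@filter_ex _ F _ _ (filterI FK FU)).
Qed.

End Metric_topology.

(** * Inner regularity and the support of a measure *)

Section Measures.
Context {R : realType} (X : pmms R).
Local Notation mu := (pmms_measure X).

(** Ulam's argument. At scale 1/(m+1), finitely many balls about a dense sequence cover [G] up to
    mass eta/2^(m+2), by continuity from above. The part of [G] covered at all scales is closed and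
    totally bounded, hence compact. *)
Lemma compact_approximation (G : set X) (eta : R) :
  closed G -> (mu G < +oo)%E -> 0 < eta ->
  exists K, [/\ compact K, K `<=` G & (mu (G `\` K) < eta%:E)%E].
Proof.
move=> clG fG eta0.
have [d dd] := separable_dense_seq (@pmms_separable R X).
pose F m n : set (borel X) := G `\` \bigcup_(i < n) cball (d i) m.+1%:R^-1.
have clU m n : closed (\bigcup_(i < n) cball (d i) m.+1%:R^-1).
  by apply: closed_bigcup => [|i _]; [exact: finite_II|exact: closed_cball].
have mG : measurable (G : set (borel X)) by exact: borel_closed.
have mF m n : measurable (F m n).
  by apply: measurableD => //; exact: borel_closed.
have F0 m : \bigcap_n F m n = set0.
  rewrite -subset0 => p Fp; have m0 : 0 < m.+1%:R^-1 :> R by rewrite invr_gt0.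
  have [n np] := dd p _ m0.
  have [_] := Fp n.+1 I; apply; exists n => //=; exact: ltW.
have small m : exists n, (mu (F m n) < (eta / 2 / (2 ^ m.+1)%:R)%:E)%E.
  have : mu \o F m @ \oo --> mu (\bigcap_n F m n).
    apply: nonincreasing_cvg_mu => //.
    - by rewrite (le_lt_trans _ fG)// le_measure //; [exact: mem_set|exact: mem_set|move=> x []].
    - by rewrite F0.
    - move=> n k nk; apply/subsetPset; apply: setDS => x [i /= ni ix].
      by exists i => //=; exact: leq_trans nk.
  rewrite F0 measure0 => /fine_cvgP[fF] /cvgrPdist_lt.
  have e0 : 0 < eta / 2 / (2 ^ m.+1)%:R by rewrite !divr_gt0// ltr0n expn_gt0.
  move=> /(_ _ e0) cF; near \oo => n; exists n.
  have fn : mu (F m n) \is a fin_num by near: n.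
  rewrite -(fineK fn) lte_fin; apply: le_lt_trans (ler_norm _) _.
  by rewrite -normrN -sub0r; near: n.
have [N hN] := choice small.
pose K := G `&` \bigcap_m \bigcup_(i < N m) cball (d i) m.+1%:R^-1.
have clK : closed K by apply: closedI => //; apply: closed_bigI => m _; exact: clU.
exists K; split.
- apply: totally_bounded_compact => //; first exact: pmms_complete.
  move=> e e0; exists d.
  have [m] := ltr_add_invr e0; rewrite add0r => me.
  exists (N m) => p [_ /(_ m I)[i /= iN pi]]; exists i => //=.
  exact: le_trans pi (ltW me).
- by move=> p [].
- apply: (@le_lt_trans _ _ (\sum_(m <oo) mu (F m (N m)))%E).
    apply: measure_sigma_subadditive => //.
    + by apply: measurableD => //; exact: borel_closed.
    + move=> p [Gp nKp]; apply: contrapT => nF; apply: nKp; split => // m _.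
      by apply: contrapT => h; apply: nF; exists m.
  (* The losses add up to at most eta/2, which leaves room for the strict inequality. *)
  apply: (@le_lt_trans _ _ (eta / 2)%:E); last by rewrite lte_fin; lra.
  apply: le_trans (@epsilon_trick0 _ (eta / 2) xpredT _); last lra.
  by apply: lee_nneseries => // m _; exact: ltW.
Unshelve. all: by end_near. Qed.

Lemma closed_spt : closed (spt mu).
Proof. by apply: closed_bigI => C []. Qed.

(** The complement is a union of possibly uncountably many null open sets. By separability,
    countably many null balls with centres in a dense sequence and radii 1/(m+1) cover it. *)
Lemma spt_compl_null : mu (~` spt mu) = 0%E.
Proof.
have [d dd] := separable_dense_seq (@pmms_separable R X).
pose B (x : nat * nat) : set (borel X) := ball (d x.1) x.2.+1%:R^-1.
pose A n : set (borel X) :=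
  if choice.unpickle n is Some x then if mu (B x) == 0%E then B x else set0 else set0.
have mB x : measurable (B x).
  by apply: sub_sigma_algebra; exact: open_mball.
have mA n : measurable (A n).
  by rewrite /A; case: choice.unpickle => // x; case: ifP.
have A0 n : mu (A n) = 0%E.
  by rewrite /A; case: choice.unpickle => // x; case: ifPn => // /eqP.
apply/eqP; rewrite eq_le measure_ge0 andbT.
apply: (@le_trans _ _ (\sum_(n <oo) mu (A n))%E); last first.
  by rewrite eseries0// => n _ _; exact: A0.
apply: measure_sigma_subadditive => //.
  by apply: measurableC; apply: borel_closed; exact: closed_spt.
move=> p /= /existsNP[C /not_implyP[[clC C0] nCp]].
have : nbhs p (~` C) by apply: open_nbhs_nbhs; split => //; exact: closed_openC.
move=> /nbhs_ballP[e /= e0 eC].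
have e20 : 0 < e / 2 by rewrite divr_gt0.
have [m] := ltr_add_invr e20; rewrite add0r => me.
have m0 : 0 < m.+1%:R^-1 :> R by rewrite invr_gt0.
have [n np] := dd p _ m0.
exists (choice.pickle (n, m)) => //; rewrite /A choice.pickleK ifT; last first.
  apply/eqP/le_anti; rewrite measure_ge0 andbT -C0; apply: le_measure.
  - by apply/mem_set; exact: mB.
  - by apply/mem_set; apply: measurableC; exact: borel_closed.
  move=> q; rewrite /B ballEmdist/= => nq; apply: eC; rewrite ballEmdist/=.
  have := metric_triangle p (d n) q; rewrite (metric_sym p (d n)) => /le_lt_trans; apply.
  by rewrite (splitr e) ltrD ?(lt_trans _ me).
by rewrite /B ballEmdist.
Unshelve. all: by end_near. Qed.

End Measures.

(** * Lipschitz functions between two bounds, and capped infima *)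

Section Lipschitz_and_infima.
Context {R : realType}.

(* McShane's extension formula. *)
Lemma lipschitz_between (Z : metricType R) (L : R) (l u : Z -> R) :
  0 <= L -> (forall p, -1 <= l p) -> (forall p, u p <= 1) ->
  (forall p q, l p - u q <= L * mdist p q) ->
  exists h : Z -> R, (forall p, l p <= h p <= u p) /\
    (forall p q, `|h p - h q| <= L * mdist p q).
Proof.
move=> L0 l1 u1 lu.
pose S s := [set l p - L * mdist p s | p in setT].
(* The mixed bound [lu] keeps the supremum below [u]; the term with [p = s] keeps it above [l]. *)
have uS s : ubound (S s) (u s) by move=> _ [p _ <-]; have := lu p s; lra.
have S0 s : has_sup (S s).
  by split; [exists (l s - L * mdist s s), s|exists (u s)].
have leS p s : l p - L * mdist p s <= sup (S s).
  by apply: ub_le_sup; [have [] := S0 s|exists p].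
have hL p q : sup (S p) - sup (S q) <= L * mdist p q.
  rewrite lerBlDr; apply: ge_sup; first by have [] := S0 p.
  move=> _ [s _ <-]; have := leS s q.
  have := ler_wpM2l L0 (metric_triangle s p q); lra.
exists (fun s => sup (S s)); split => [s|p q].
  apply/andP; split; first by have := leS s s; rewrite mdistxx mulr0 subr0.
  by apply: ge_sup; [have [] := S0 s|exact: uS].
rewrite ler_norml (hL p q) andbT.
by have := hL q p; rewrite (metric_sym q p); lra.
Qed.

Lemma inf_half_le2 (P : R -> Prop) : inf_half P <= 2^-1.
Proof.
rewrite /inf_half; case: asboolP => // -[e [/andP[e0 e2] Pe]].
apply: le_trans (ltW e2); apply: ge_inf; last by split => //; apply/andP.
by exists 0 => d [/andP[/ltW]].
Qed.

Lemma inf_half_ge0 (P : R -> Prop) : 0 <= inf_half P.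
Proof.
rewrite /inf_half; case: asboolP => // h.
by apply: lb_le_inf => // d [/andP[/ltW]].
Qed.

Lemma inf_half_le (P : R -> Prop) (e : R) : 0 < e -> P e -> inf_half P <= e.
Proof.
move=> e0 Pe; have [e2|] := ltP e 2^-1; last exact: le_trans (inf_half_le2 P).
rewrite /inf_half; case: asboolP => h; last first.
  by exfalso; apply: h; exists e; split => //; apply/andP.
apply: ge_inf; last by split => //; apply/andP.
by exists 0 => d [/andP[/ltW]].
Qed.

(** For [e] above 1/2 the default value of [inf_half] would be less than [e] without any witness. *)
Lemma inf_half_lt (P : R -> Prop) (e : R) : inf_half P < e -> e <= 2^-1 ->
  exists d, [/\ 0 < d, d < e & P d].
Proof.
rewrite /inf_half; case: asboolP => [h|_ + e2]; last by rewrite ltNge e2.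
move=> /(inf_lt h)[d [/andP[d0 _] Pd] de] _.
by exists d.
Qed.

Lemma inf_lt_elem (E : set R) (e : R) : E !=set0 -> inf E < e ->
  exists2 d, E d & d < e.
Proof. by move=> E0 /(inf_lt E0)[d Ed de]; exists d. Qed.

End Lipschitz_and_infima.

(** * Integrals of bounded functions with bounded support *)

Section Integrals.
Context {R : realType}.

(** A class containing the test functions, on which integrals are finite and linear. The measures
    are finite on balls but may have infinite total mass, whence the bound on the support. *)
Definition bounded_bsupp (X : pmetricType R) (h : X -> R) :=
  [/\ measurable_fun setT (h : borel X -> R),
      exists M, forall p, `|h p| <= M
    & exists r, forall p, r < mdist point p -> h p = 0].

Lemma bounded_bsuppD (X : pmetricType R) (h k : X -> R) :
  bounded_bsupp h -> bounded_bsupp k -> bounded_bsupp (fun p => h p + k p).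
Proof.
move=> [mh [M hM] [r hr]] [mk [N kN] [s ks]]; split.
- exact: measurable_funD.
- by exists (M + N) => p; rewrite (le_trans (ler_normD _ _))// lerD.
- exists (Num.max r s) => p; rewrite gt_max => /andP[rp sp].
  by rewrite hr// ks// addr0.
Qed.

Lemma bounded_bsuppN (X : pmetricType R) (h : X -> R) :
  bounded_bsupp h -> bounded_bsupp (fun p => - h p).
Proof.
move=> [mh [M hM] [r hr]]; split.
- exact: measurableT_comp.
- by exists M => p; rewrite normrN.
- by exists r => p /hr ->; rewrite oppr0.
Qed.

Lemma bounded_bsupp_restrict (X : pmetricType R) (K : set X) (h : X -> R) :
  measurable (K : set (borel X)) -> bounded_bsupp h -> bounded_bsupp (h \_ K).
Proof.
move=> mK [mh [M hM] [r hr]]; split.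
- apply: (measurable_restrictT _ mK).1.
  exact: measurable_funS mh.
- exists M => p; rewrite patchE; case: ifP => // _.
  by rewrite normr0 (le_trans _ (hM p)).
- by exists r => p /hr rp; rewrite patchE rp if_same.
Qed.

Lemma bounded_bsupp_indic (X : pmetricType R) (N : set X) (r : R) :
  measurable (N : set (borel X)) -> N `<=` cball point r ->
  bounded_bsupp (\1_N : X -> R).
Proof.
move=> mN Nr; split.
- exact: measurable_indic.
- by exists 1 => p; rewrite indicE; case: (_ \in _) => //=; rewrite ?normr1// normr0.
- exists r => p rp; rewrite indicE memNset// => /Nr; rewrite /cball/= leNgt.
  by rewrite rp.
Qed.

Lemma test_bounded_bsupp (Z : pmetricType R) (L r : R) (h : Z -> R) :
  test_functions point L r h -> bounded_bsupp h.
Proof.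
move=> [h1 hL hs]; split.
- by apply: continuous_borel_real; exact: lipschitz_continuous hL.
- by exists 1 => p; rewrite ler_norml.
- exists r => p rp; apply/eqP; apply: contraPT rp => hp0; apply/negP.
  rewrite -leNgt; apply: hs; exact: subset_closure.
Qed.

Lemma bounded_bsupp_comp (X Z : pmetricType R) (f : X -> Z) (h : Z -> R) :
  pointed_isometry f -> bounded_bsupp h -> bounded_bsupp (h \o f).
Proof.
move=> fI [mh [M hM] [r hr]]; split.
- have mf := pointed_isometry_measurable fI.
  exact: (@measurableT_comp _ _ _ (borel X) (borel Z) _ h setT f mh mf).
- by exists M => p; exact: hM.
- by exists r => p rp; apply: hr; rewrite -(proj1 fI) (proj2 fI).
Qed.

Section Space.
Variable X : pmms R.
Local Notation mu := (pmms_measure X).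

Definition integ (h : X -> R) : R := fine (\int[mu]_p (h p)%:E)%E.

Lemma bounded_bsupp_integrable (h : X -> R) :
  bounded_bsupp h -> mu.-integrable setT (EFin \o h).
Proof.
move=> [mh [M hM] [r hr]].
have mB : measurable (cball point r : set (borel X)).
  by apply: borel_closed; exact: closed_cball.
have -> : EFin \o h = (EFin \o h) \_ (cball point r).
  apply/funext => p; rewrite patchE; case: ifPn => // /negP pr /=.
  by rewrite hr// ltNge; apply/negP => rp; apply: pr; exact: mem_set.
apply/(integrable_mkcond _ mB); apply: measurable_bounded_integrable => //.
- exact: pmms_locfin.
- exact: measurable_funS mh.
- by exists M; split; [exact: num_real|move=> N MN p _ /=; exact: le_trans (ltW MN)].
Qed.

Lemma integE (h : X -> R) : bounded_bsupp h ->
  (\int[mu]_p (h p)%:E)%E = (integ h)%:E.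
Proof.
move=> /bounded_bsupp_integrable hi; rewrite /integ fineK//.
exact: integrable_fin_num.
Qed.

Lemma integD (h k : X -> R) : bounded_bsupp h -> bounded_bsupp k ->
  integ (fun p => h p + k p) = integ h + integ k.
Proof.
move=> /bounded_bsupp_integrable hi /bounded_bsupp_integrable ki.
exact: (RintegralD measurableT hi ki).
Qed.

Lemma integN (h : X -> R) : bounded_bsupp h ->
  integ (fun p => - h p) = - integ h.
Proof.
move=> hb; have := integD hb (bounded_bsuppN hb).
under [X in integ X]funext do rewrite subrr.
by rewrite {1}/integ integral0 /=; lra.
Qed.

Lemma integ_indic (N : set X) : measurable (N : set (borel X)) ->
  integ \1_N = fine (mu N).
Proof.
move=> mN; congr fine; rewrite -[in RHS](setIT (N : set (borel X))).
exact: (integral_indic mu measurableT mN).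
Qed.

Lemma integ_spt (h : X -> R) : bounded_bsupp h ->
  integ h = fine (\int[mu]_(p in spt mu) (h p)%:E)%E.
Proof.
move=> hb; congr fine.
have ms : measurable (spt mu : set (borel X)) by apply: borel_closed; exact: closed_spt.
rewrite (negligible_integral (measurableC ms) measurableT _ (spt_compl_null X)).
  by rewrite setTD setCK.
exact: bounded_bsupp_integrable.
Qed.

(** The complement of the support is null. The functions compared below are in general controlled
    only on the support. *)
Lemma le_integ (h k : X -> R) : bounded_bsupp h -> bounded_bsupp k ->
  (forall p, spt mu p -> h p <= k p) -> integ h <= integ k.
Proof.
move=> hb kb hk; rewrite !integ_spt//.
have ms : measurable (spt mu : set (borel X)) by apply: borel_closed; exact: closed_spt.
have sp g : bounded_bsupp g -> mu.-integrable (spt mu) (EFin \o g).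
  by move=> /bounded_bsupp_integrable; apply: integrableS.
by apply: le_Rintegral => //; exact: sp.
Qed.

Lemma integral_pushforward_isometry (Z : pmetricType R) (f : X -> Z) (h : Z -> R) :
  pointed_isometry f -> bounded_bsupp h ->
  (\int[pushforward (T1 := borel X) (T2 := borel Z) mu f]_p (h p)%:E)%E
  = (integ (h \o f))%:E.
Proof.
move=> fI hb; rewrite -integE; last exact: bounded_bsupp_comp.
rewrite (@integral_pushforward _ _ (borel X) (borel Z))//.
- exact: pointed_isometry_measurable.
- by apply/measurable_EFinP; case: hb.
- by apply: bounded_bsupp_integrable; exact: bounded_bsupp_comp.
Qed.

End Space.

End Integrals.

(** * Integration against a restricted measure *)

Section Restriction_integrals.
Context {R : realType} (X : pmms R) (K : set X) (cK : compact K) (Kx : K point).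
Local Notation mu := (pmms_measure X).
Local Notation val := (set_val : pointed_sub Kx -> X).

Lemma pointed_isometry_val : pointed_isometry val.
Proof. by []. Qed.

Lemma pushforward_restr (A : set X) :
  pmms_measure (restr cK Kx) (val @^-1` A) = mu (A `&` K).
Proof.
congr (pmms_measure X _); apply/seteqP; split => [_ [p Ap <-]|p [Ap Kp]].
  by split => //; exact: set_valP.
by exists (exist _ p (mem_set Kp)).
Qed.

(** A change of variables: the inclusion of [K] pushes the restricted measure forward to one that
    agrees with [mu] on Borel subsets of [K]. *)
Lemma integ_restr (h : X -> R) : bounded_bsupp h ->
  integ (h \o val : restr cK Kx -> R) = integ (h \_ K).
Proof.
move=> hb; pose nu := pmms_measure (restr cK Kx).
have mK : measurable (K : set (borel X)) by apply: borel_closed; exact: closed_compact.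
have mv := pointed_isometry_measurable pointed_isometry_val.
have mh : measurable_fun [set: borel X] (EFin \o h).
  by apply/measurable_EFinP; case: hb.
have ih : nu.-integrable (val @^-1` K) ((EFin \o h) \o val).
  have -> : val @^-1` K = setT by apply/seteqP; split => // p _; exact: set_valP.
  have := bounded_bsupp_comp pointed_isometry_val hb.
  exact: (@bounded_bsupp_integrable _ (restr cK Kx)).
have := integral_pushforward mv mh ih mK.
have -> : val @^-1` K = setT by apply/seteqP; split => // p _; exact: set_valP.
rewrite /integ => <-; congr fine.
rewrite (@eq_measure_integral _ (borel X) _ K mu); last first.
  move=> A mA AK; transitivity (mu (A `&` K)); first exact: pushforward_restr.
  by rewrite setIidl.
by rewrite integral_mkcond; apply: eq_integral => p _; rewrite restrict_EFin.
Qed.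

End Restriction_integrals.

Local Notation push mu f := (pushforward (T1 := borel _) (T2 := borel _) mu f).

(** * Bounds on the distances, and the converse direction *)

Section Distance_bounds.
Context {R : realType}.
Implicit Types X Y : pmms R.

Lemma test_functions_mono (Z : pmetricType R) (z : Z) (L L' r r' : R) :
  L <= L' -> r <= r' -> test_functions z L r `<=` test_functions z L' r'.
Proof.
move=> LL rr h [h1 hL hs]; split => //.
  by move=> p q; rewrite (le_trans (hL p q))// ler_wpM2r// mdist_ge0.
by move=> p /hs; rewrite /cball/= => /le_trans; apply.
Qed.

Lemma test_functions_comp (W Z : pmetricType R) (J : W -> Z) (L r : R) (h : Z -> R) :
  pointed_isometry J ->
  test_functions point L r h -> test_functions point L r (h \o J).
Proof.
move=> [J0 JI] [h1 hL hs]; split => [p|p q|]; first exact: h1.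
  by rewrite -JI; exact: hL.
apply: subset_trans (closure_subset (B := cball point r) _) _.
  move=> p /= hp; rewrite /cball/= -JI J0; apply: hs; exact: subset_closure.
exact: closed_cball.
Qed.

Lemma test_functionsN (Z : pmetricType R) (z : Z) (L r : R) (h : Z -> R) :
  test_functions z L r h -> test_functions z L r (fun p => - h p).
Proof.
move=> [h1 hL hs]; split => [p|p q|]; first by have := h1 p; lra.
  by rewrite -opprD normrN; exact: hL.
apply: subset_trans hs; apply: closure_subset => p /=.
by rewrite oppr_eq0.
Qed.

Section Embedded.
Context {X Y : pmms R} {Z : pmetricType R} {f : X -> Z} {g : Y -> Z}.
Hypotheses (fI : pointed_isometry f) (gI : pointed_isometry g).
Local Notation F := (FLr point (push (pmms_measure X) f) (push (pmms_measure Y) g)).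

(** Together with [FLr_lt_integ], this replaces the extended-real supremum over test functions by
    inequalities between real integrals on [X] and [Y]. *)
Lemma FLr_le (L r c : R) :
  (forall h, test_functions point L r h -> integ (h \o f) - integ (h \o g) <= c) ->
  (F L r <= c%:E)%E.
Proof.
move=> hc; apply: ge_ereal_sup => _ [h th <-].
have hb := test_bounded_bsupp th.
by rewrite !integral_pushforward_isometry// -EFinB lee_fin; exact: hc.
Qed.

Lemma FLr_lt_integ (L r c : R) (h : Z -> R) : (F L r < c%:E)%E ->
  test_functions point L r h -> integ (h \o f) - integ (h \o g) < c.
Proof.
move=> Fc th; rewrite -lte_fin; apply: le_lt_trans Fc; apply: ereal_sup_ubound.
have hb := test_bounded_bsupp th.
by exists h => //; rewrite !integral_pushforward_isometry.
Qed.

End Embedded.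

Lemma d_star_le X Y (Z : pmetricType R) (f : X -> Z) (g : Y -> Z) :
  pointed_isometry f -> pointed_isometry g ->
  d_star X Y <= Fdist point (push (pmms_measure X) f) (push (pmms_measure Y) g).
Proof.
move=> fI gI; apply: ge_inf; last by exists Z, f, g.
by exists 0 => _ [Z' [f' [g' [_ _ ->]]]]; exact: inf_half_ge0.
Qed.

Lemma d_star_lt X Y (e : R) : d_star X Y < e ->
  exists (Z : pmetricType R) (f : X -> Z) (g : Y -> Z),
  [/\ pointed_isometry f, pointed_isometry g &
    Fdist point (push (pmms_measure X) f) (push (pmms_measure Y) g) < e].
Proof.
move=> /inf_lt_elem[|_ [Z [f [g [fI gI ->]]]] de]; last by exists Z, f, g.
have [Z [f [g [fI gI]]]] := wedge X Y.
by eexists; exists Z, f, g; split.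
Qed.

Lemma d_pmGH_le X Y (Z : pmetricType R) (f : X -> Z) (g : Y -> Z) :
  pointed_isometry f -> pointed_isometry g ->
  d_pmGH X Y <= Hdist point (range f) (range g) +
    Fdist point (push (pmms_measure X) f) (push (pmms_measure Y) g).
Proof.
move=> fI gI; apply: ge_inf; last by exists Z, f, g.
by exists 0 => _ [Z' [f' [g' [_ _ ->]]]]; rewrite addr_ge0// inf_half_ge0.
Qed.

Lemma d_star_le_half X Y : d_star X Y <= 2^-1.
Proof.
have [Z [f [g [fI gI]]]] := wedge X Y.
exact: le_trans (d_star_le fI gI) (inf_half_le2 _).
Qed.

Lemma d_star_ge0 X Y : 0 <= d_star X Y.
Proof.
have [Z [f [g [fI gI]]]] := wedge X Y.
apply: lb_le_inf; first by eexists; exists Z, f, g; split.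
by move=> _ [Z' [f' [g' [_ _ ->]]]]; exact: inf_half_ge0.
Qed.

Lemma d_pmGH_le1 X Y : d_pmGH X Y <= 1.
Proof.
have [Z [f [g [fI gI]]]] := wedge X Y.
apply: le_trans (d_pmGH_le fI gI) _.
rewrite (splitr 1) !div1r lerD//; exact: inf_half_le2.
Qed.

Lemma d_star_le_d_pmGH X Y : d_star X Y <= d_pmGH X Y.
Proof.
apply: lb_le_inf.
  have [Z [f [g [fI gI]]]] := wedge X Y.
  by eexists; exists Z, f, g; split.
move=> _ [Z [f [g [fI gI ->]]]]; apply: le_trans (d_star_le fI gI) _.
by rewrite lerDr inf_half_ge0.
Qed.

(** Since [h] vanishes beyond radius [r], hence beyond [s], restricting it to [K] changes it by at
    most the indicator of the ball of radius [s] minus [K]. *)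
Lemma integ_le_restr X (K : set X) (r s : R) (h : X -> R) : compact K -> r <= s ->
  bounded_bsupp h -> (forall p, `|h p| <= 1) -> (forall p, r < mdist point p -> h p = 0) ->
  `|integ h - integ (h \_ K)| <= fine (pmms_measure X (cball point s `\` K)).
Proof.
move=> /closed_compact/borel_closed mK rs hb h1 hr.
have mN : measurable (cball point s `\` K : set (borel X)).
  by apply: measurableD => //; apply: borel_closed; exact: closed_cball.
have Kb := bounded_bsupp_restrict mK hb.
have Nb : bounded_bsupp (\1_(cball point s `\` K) : X -> R).
  by apply: (bounded_bsupp_indic mN (r := s)) => p [].
have hK p : `|h p - (h \_ K) p| <= \1_(cball point s `\` K) p.
  rewrite patchE indicE; case: ifPn => [pK|/negP pK].
    by rewrite subrr normr0 ler0n.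
  rewrite subr0; have [/hr ->|pr] := ltP r (mdist point p).
    by rewrite normr0 ler0n.
  rewrite mem_set//; split; first exact: le_trans pr rs.
  by move=> Kp; apply: pK; exact: mem_set.
rewrite -integ_indic// ler_distl lerBlDr -!integD//.
apply/andP; split; apply: le_integ => //; try exact: bounded_bsuppD.
- by move=> p _; have := hK p; rewrite ler_distl => /andP[]; lra.
- by move=> p _; have := hK p; rewrite ler_distl => /andP[]; lra.
Qed.

Lemma d_star_lt_of_restr (e : R) X Y (K : set X) (cK : compact K) (xK : K point)
    (L : set Y) (cL : compact L) (yL : L point) :
  0 < e -> small_complements e K L ->
  d_star (restr cK xK) (restr cL yL) < e -> d_star X Y < 3 * e.
Proof.
(* If [3 * e] exceeds 1/2, the cap on [d_star] suffices. Otherwise [e] is below 1/2 and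
   [inf_half_lt] provides a witness. *)
move=> e0 sKL dKL; have [e6|e6] := ltP 2^-1 (3 * e).
  exact: le_lt_trans (d_star_le_half X Y) e6.
have [Z [f [g [fI gI]]]] := d_star_lt dKL.
move=> /inf_half_lt[|e' [e'0 e'e FZ]]; first lra.
(* [Z1] glues [X] to [Z] along [K]; [Z2] glues [Y] to [Z1] along [L]. *)
have [Z1 [a [b [aI bI ab]]]] := amalgam (pointed_isometry_val xK) fI.
have bgI : pointed_isometry (b \o g).
  by split => [|p q] /=; rewrite ?(proj2 bI) ?(proj2 gI)// (proj1 gI) (proj1 bI).
have [Z2 [c [d [cI dI cd]]]] := amalgam (pointed_isometry_val yL) bgI.
have daI : pointed_isometry (d \o a).
  by split => [|p q] /=; rewrite ?(proj2 dI) ?(proj2 aI)// (proj1 aI) (proj1 dI).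
have dbI : pointed_isometry (d \o b).
  by split => [|p q] /=; rewrite ?(proj2 dI) ?(proj2 bI)// (proj1 bI) (proj1 dI).
set mx := fine (pmms_measure X (cball point e^-1 `\` K)).
set my := fine (pmms_measure Y (cball point e^-1 `\` L)).
have fin (V : pmms R) (M : set V) : compact M ->
    (pmms_measure V (cball point e^-1 `\` M) < e%:E)%E ->
    fine (pmms_measure V (cball point e^-1 `\` M)) < e.
  move=> cM h; rewrite -lte_fin fineK//; apply: fin_real.
  by rewrite (lt_le_trans _ (measure_ge0 _ _))//= (lt_trans h)// ltry.
move: sKL; rewrite /small_complements gt_max => /andP[/(fin _ _ cK) mxe /(fin _ _ cL) mye].
(* The midpoint lies strictly between the total error [e' + mx + my] and [3 * e]. The maximum with
   [e] confines test functions at scale [h0] to B(z,1/e), where the complements are small. *)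
pose h0 := Num.max e ((e' + mx + my + 3 * e) / 2).
have h0e : e <= h0 by rewrite le_max lexx.
have h03 : h0 < 3 * e by rewrite gt_max; apply/andP; split; rewrite -/mx -/my in mxe mye; lra.
have h0s : e' + mx + my < h0.
  by rewrite lt_max; apply/orP; right; rewrite -/mx -/my in mxe mye; lra.
apply: le_lt_trans (d_star_le daI cI) _; apply: le_lt_trans h03.
apply: inf_half_le; first exact: lt_le_trans e0 h0e.
apply: (@le_lt_trans _ _ (e' + mx + my)%:E); last by rewrite lte_fin.
apply: FLr_le => // t tt.
have h0i : h0^-1 <= e^-1 by rewrite lef_pV2// posrE (lt_le_trans e0).
have hei : h0^-1 <= e'^-1.
  by rewrite lef_pV2// ?posrE ?(lt_le_trans e0)// (le_trans (ltW e'e)).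
have side (V : pmms R) (M : set V) (cM : compact M) (v : V -> Z2) : pointed_isometry v ->
    `|integ (t \o v) - integ ((t \o v) \_ M)| <=
      fine (pmms_measure V (cball point e^-1 `\` M)).
  move=> vI; have [t1 _ ts] := tt.
  apply: (integ_le_restr cM h0i).
  - exact: bounded_bsupp_comp (test_bounded_bsupp tt).
  - by move=> p; rewrite ler_norml; exact: t1.
  move=> p rp; apply/eqP; apply: contraPT rp => tp0; apply/negP.
  rewrite -leNgt -(proj2 vI) (proj1 vI); apply: ts; exact: subset_closure.
have tb := test_bounded_bsupp tt.
have := side X K cK _ daI; have := side Y L cL _ cI.
rewrite -(integ_restr cK xK); last exact: bounded_bsupp_comp.
rewrite -(integ_restr cL yL); last exact: bounded_bsupp_comp.
have tt' := test_functions_comp dbI (test_functions_mono hei hei tt).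
have := FLr_lt_integ fI gI FZ tt'.
have -> : (t \o (d \o b)) \o f = (t \o (d \o a)) \o set_val.
  by apply/funext => p /=; rewrite -ab.
have -> : (t \o (d \o b)) \o g = (t \o c) \o set_val.
  by apply/funext => p /=; rewrite cd.
rewrite !ler_norml -/mx -/my => ? /andP[? ?] /andP[? ?]; lra.
Qed.

End Distance_bounds.

(** * Points near the support of the other measure *)

Section Near_support.
Context {R : realType} {X Y : pmms R} {Z : pmetricType R}.
Variables (f : X -> Z) (g : Y -> Z) (d : R).
Hypotheses (fI : pointed_isometry f) (gI : pointed_isometry g) (d0 : 0 < d).

Let target : set Z := (g @` spt (pmms_measure Y)) `|` [set s | d^-1 < mdist point s].

(* Points close to the complement of B(z,1/d) are included because a test
   function detecting the other points has to vanish there. *)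
Definition near_support : set X := [set p | forall c, 0 < c ->
  exists2 s, ((g @` spt (pmms_measure Y)) `|` [set s | d^-1 < mdist point s]) s
    & mdist (f p) s < d + c].

Lemma not_near_support p s : ~ near_support p -> target s -> d <= mdist (f p) s.
Proof.
move=> np ts; rewrite leNgt; apply/negP => ps; apply: np => c c0.
by exists s => //; rewrite (lt_trans ps)// ltrDl.
Qed.

(** The slack [c] turns the condition into a bound by [d] on the infimal distance to the target, and
    such a bound passes to limits. *)
Lemma closed_near_support : closed near_support.
Proof.
rewrite -openC openE => p /= /existsNP[c /not_implyP[c0 nc]].
have c20 : 0 < c / 2 by rewrite divr_gt0.
apply/nbhs_ballP; exists (c / 2) => //= q.
rewrite ballEmdist/= => pq /(_ _ c20)[s ts qs]; apply: nc; exists s => //.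
have := metric_triangle (f p) (f q) s; rewrite (proj2 fI) => /le_lt_trans; apply.
by rewrite (splitr c) addrA addrC ltrD.
Qed.

Hypothesis FXY : forall h : Z -> R, test_functions point d^-1 d^-1 h ->
  integ (h \o f) - integ (h \o g) < d.

(** The bound is uniform in [r]: the image of a point outside B(x,1/d) is itself in [target], so all
    far points lie in that ball. *)
Lemma measure_far_lt (r : R) :
  fine (pmms_measure X (cball point r `\` near_support)) < d.
Proof.
set N := cball point r `\` near_support.
have mN : measurable (N : set (borel X)).
  by apply: measurableD; apply: borel_closed; [exact: closed_cball|exact: closed_near_support].
(* [l] forces the value 1 at far points and [u] the value 0 on the target; the gap [d] between the
   two sets is what a 1/d-Lipschitz function needs. *)
pose far s := forall q, target q -> d <= mdist s q.
pose l s : R := if `[< far s >] then 1 else 0.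
pose u s : R := if `[< target s >] then 0 else 1.
have l01 s : 0 <= l s <= 1 by rewrite /l; case: ifP => _; rewrite ?ler01 ?lexx.
have u01 s : 0 <= u s <= 1 by rewrite /u; case: ifP => _; rewrite ?ler01 ?lexx.
have [||||h [lhu hL]] := @lipschitz_between R Z d^-1 l u.
- by rewrite invr_ge0 ltW.
- by move=> p; have := l01 p; lra.
- by move=> p; have := u01 p; lra.
- move=> p q; have dpq : 0 <= d^-1 * mdist p q by rewrite mulr_ge0 ?mdist_ge0// invr_ge0 ltW.
  rewrite /l /u; case: asboolP => [fp|_]; case: asboolP => [tq|_]; try lra.
  by rewrite subr0 mulrC ler_pdivlMr// mul1r; exact: fp.
have h0 s : target s -> h s = 0.
  by move=> ts; have := lhu s; have := l01 s; rewrite /u asboolT//; lra.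
have th : test_functions point d^-1 d^-1 h.
  split => //.
  - by move=> p; have := lhu p; have := l01 p; have := u01 p; lra.
  - apply: subset_trans (closure_subset (B := cball point d^-1) _) _.
      move=> p /= hp; rewrite /cball/= leNgt; apply/negP => op.
      by move/eqP: hp; apply; apply: h0; right.
    exact: closed_cball.
have hb := test_bounded_bsupp th.
have hgb := bounded_bsupp_comp gI hb.
have hg : integ (h \o g) <= 0.
  (* On the support of the second measure [h \o g] vanishes, so it is at most its own negative
     there. *)
  suff : integ (h \o g) <= integ (fun q => - (h \o g) q) by rewrite integN//; lra.
  apply: le_integ => //; first exact: bounded_bsuppN.
  by move=> q sq /=; rewrite h0 ?oppr0//; left; exists q.
have Nb : bounded_bsupp (\1_N : X -> R) by apply: (bounded_bsupp_indic mN (r := r)) => p [].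
have hf : integ \1_N <= integ (h \o f).
  apply: le_integ => //; first exact: bounded_bsupp_comp.
  move=> p _ /=; have := lhu (f p); rewrite indicE.
  case: (boolP (p \in N)) => [|_]; last by have := l01 (f p); rewrite /=; lra.
  move=> /set_mem[_ np]; rewrite /l asboolT; first by rewrite /=; lra.
  by move=> q tq; exact: not_near_support.
by move: hf; rewrite integ_indic//; have := FXY th; lra.
Qed.

(** The open sets [U q] cover the part of [K] in B(x,1/(2d)), and compactness leaves finitely many.
    The first numerical bound keeps the net in the ball of radius [r]; the second excludes target
    points outside B(z,1/d), which need not come from the support. *)
Lemma finite_net (K : set X) (r : R) : compact K -> K `<=` near_support ->
  (2 * d)^-1 + 2 * d <= r -> r < d^-1 ->
  exists F : set Y, [/\ finite_set F,
    F `<=` spt (pmms_measure Y) `&` cball point r,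
    (forall p, K p -> mdist point p <= (2 * d)^-1 ->
       exists2 q, F q & mdist (f p) (g q) < 2 * d)
    & forall q, F q -> exists2 p, K p & mdist (f p) (g q) < 2 * d].
Proof.
move=> cK Kn dr rd; pose K1 := K `&` cball point (2 * d)^-1.
have cK1 : compact K1 by apply: compact_closedI => //; exact: closed_cball.
pose D := [set q | [/\ spt (pmms_measure Y) q, mdist point q <= r
  & exists2 p, K p & mdist (f p) (g q) < 2 * d]].
pose U q := [set p | mdist (f p) (g q) < 2 * d].
have oU q : D q -> open (U q).
  move=> _; rewrite openE => p; rewrite /U/= => pq.
  apply/nbhs_ballP; exists (2 * d - mdist (f p) (g q)); rewrite /= ?subr_gt0// => p'.
  rewrite ballEmdist/=; have := metric_triangle (f p') (f p) (g q).
  by rewrite (proj2 fI) (metric_sym p'); lra.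
have K1U : K1 `<=` cover D U.
  (* Taking the slack equal to [d] gives a target point at distance less than [2 * d]. *)
  move=> p [Kp pz]; rewrite /cball/= in pz; have [s ts ps] := Kn _ Kp _ d0.
  have sz := metric_triangle point (f p) s.
  have pz' : mdist point (f p) = mdist point p by rewrite -(proj1 fI) (proj2 fI).
  have sr : mdist point s <= r.
    by apply: le_trans sz _; apply: le_trans dr; rewrite pz' lerD//; lra.
  case: ts => [[q sq qs]|/= ds]; last by lra.
  have pq : mdist (f p) (g q) < 2 * d by rewrite qs; lra.
  exists q => //; split => //; last by exists p.
  by rewrite -(proj2 gI) (proj1 gI) qs.
move: cK1; rewrite compact_cover => /(_ _ _ _ oU K1U)[D' D'D K1D'].
exists [set` D']; split.
- exact: finite_fset.
- by move=> q /D'D /set_mem[].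
- by move=> p Kp pz; have [q qD' pq] := K1D' p (conj Kp pz); exists q.
- by move=> q /D'D /set_mem[].
Qed.

End Near_support.

Lemma fine_cball_lt {R : realType} (X : pmms R) (N : set X) (r e : R) :
  measurable (N : set (borel X)) -> N `<=` cball point r ->
  fine (pmms_measure X N) < e -> (pmms_measure X N < e%:E)%E.
Proof.
move=> mN Nr Ne; rewrite -(fineK (x := pmms_measure X N)) ?lte_fin//.
apply: fin_real; rewrite (lt_le_trans _ (measure_ge0 _ _))//=.
apply: le_lt_trans (pmms_locfin point r); apply: le_measure => //; apply/mem_set => //.
by apply: borel_closed; exact: closed_cball.
Qed.

(** Off [K], the function [b] can be negative on the support only in [N], where [b >= -1] costs at
    most the mass of [N]. In the application [N] is what the compact approximation loses. *)
Lemma integ_restrict_le {R : realType} (X : pmms R) (K N : set X) (r : R) (a b : X -> R) :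
  compact K -> measurable (N : set (borel X)) -> N `<=` cball point r ->
  bounded_bsupp a -> bounded_bsupp b -> (forall p, -1 <= b p) ->
  (forall p, spt (pmms_measure X) p -> K p -> a p <= b p) ->
  (forall p, spt (pmms_measure X) p -> ~ K p -> ~ N p -> 0 <= b p) ->
  integ (a \_ K) <= integ b + fine (pmms_measure X N).
Proof.
move=> /closed_compact/borel_closed mK mN Nr ab bb b1 abK bN.
have Nb := bounded_bsupp_indic mN Nr.
rewrite -integ_indic// -integD//; apply: le_integ.
- exact: bounded_bsupp_restrict.
- exact: bounded_bsuppD.
move=> p sp; rewrite patchE indicE; case: ifPn => [pK|/negP pK].
  by rewrite (le_trans (abK p sp (set_mem pK)))// lerDl ler0n.
rewrite -[X in X <= _]/(0 : R).
case: (boolP (p \in N)) => [_|/negP pN]; first by have := b1 p; rewrite /=; lra.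
rewrite addr0; apply: bN => //.
- by move=> Kp; apply: pK; exact: mem_set.
- by move=> Np; apply: pN; exact: mem_set.
Qed.

(** Up to a null set, the ball minus [K] is covered by the part outside [G] and the part of [G] in
    the support that [K0] misses. *)
Lemma fine_complement_lt {R : realType} (X : pmms R) (K0 K G : set X) (r c eta : R) :
  compact K -> closed G -> measurable (K0 : set (borel X)) -> K0 `<=` K ->
  fine (pmms_measure X (cball point r `\` G)) < c ->
  fine (pmms_measure X (spt (pmms_measure X) `&` cball point r `&` G `\` K0)) < eta ->
  (pmms_measure X (cball point r `\` K) < (c + eta)%:E)%E.
Proof.
move=> /closed_compact/borel_closed mK /borel_closed mG mK0 K0K.
have mB : measurable (cball point r : set (borel X)).
  by apply: borel_closed; exact: closed_cball.
have ms : measurable (spt (pmms_measure X) : set (borel X)).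
  by apply: borel_closed; exact: closed_spt.
set A := _ `\` G; set B := _ `\` K0 => Ac Beta.
have mA : measurable (A : set (borel X)) by exact: measurableD.
have mB' : measurable (B : set (borel X)).
  by apply: measurableD => //; apply: measurableI => //; exact: measurableI.
have Ar : A `<=` cball point r by move=> p [].
have Br : B `<=` cball point r by move=> p [[[]]].
have Dr : cball point r `\` K `<=` cball point r by move=> p [].
have mD : measurable (cball point r `\` K : set (borel X)) by exact: measurableD.
apply: (fine_cball_lt mD Dr).
suff : fine (pmms_measure X (cball point r `\` K)) <=
  fine (pmms_measure X A) + fine (pmms_measure X B) by lra.
rewrite -!integ_indic// -integD; [|exact: bounded_bsupp_indic Ar|exact: bounded_bsupp_indic Br].
apply: le_integ; first exact: bounded_bsupp_indic Dr.
  by apply: bounded_bsuppD; [exact: bounded_bsupp_indic Ar|exact: bounded_bsupp_indic Br].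
move=> p sp; rewrite !indicE; case: (boolP (p \in _ `\` K)) => [|_]; last by rewrite addr_ge0.
move=> /set_mem[pr nK]; have [Gp|nG] := pselect (G p).
  by rewrite (mem_set (_ : B p)) ?lerDr//; split => // /K0K.
by rewrite (mem_set (_ : A p)) ?lerDl.
Qed.

(** * Construction of the compact pieces *)

Section Compact_pieces.
Context {R : realType}.

(** The bounds [l] and [u] equal [t] on [A1] and [A2], and 0 on the rest of [B1] and [B2] and
    outside the ball. The two separations handle [t] against 0 on a discarded part; outside the ball
    0 is the value of [t], so its Lipschitz bound applies. *)
Lemma modified_test (Z : pmetricType R) (t : Z -> R) (d e : R) (A1 A2 B1 B2 : set Z) :
  0 < d -> d <= e -> test_functions point e^-1 e^-1 t ->
  (forall p q, A1 p -> B2 q -> d <= mdist p q) ->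
  (forall p q, B1 p -> A2 q -> d <= mdist p q) ->
  exists h, [/\ test_functions point d^-1 d^-1 h,
    forall s, A1 s -> t s <= h s,
    forall s, A2 s -> h s <= t s,
    forall s, ~ A1 s -> B1 s \/ e^-1 < mdist point s -> 0 <= h s
    & forall s, ~ A2 s -> B2 s \/ e^-1 < mdist point s -> h s <= 0].
Proof.
move=> d0 de [t1 tL ts] AB BA.
have e0 : 0 < e by exact: lt_le_trans de.
have ed : e^-1 <= d^-1 by rewrite lef_pV2.
pose O (s : Z) : Prop := e^-1 < mdist point s.
have tO s : O s -> t s = 0.
  move=> Os; apply/eqP; apply: contraPT Os => ts0; apply/negP.
  by rewrite -leNgt; apply: ts; exact: subset_closure.
pose l s : R := if `[< A1 s >] then t s else if `[< B1 s \/ O s >] then 0 else -1.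
pose u s : R := if `[< A2 s >] then t s else if `[< B2 s \/ O s >] then 0 else 1.
have l1 s : -1 <= l s <= 1.
  by rewrite /l; case: ifP => _; [exact: t1|case: ifP => _; lra].
have u1 s : -1 <= u s <= 1.
  by rewrite /u; case: ifP => _; [exact: t1|case: ifP => _; lra].
have tLd p q : t p - t q <= d^-1 * mdist p q.
  apply: le_trans (ler_norm _) _; apply: le_trans (tL p q) _.
  by rewrite ler_wpM2r// mdist_ge0.
have dM (p q : Z) : d <= mdist p q -> 1 <= d^-1 * mdist p q.
  by rewrite mulrC ler_pdivlMr// mul1r.
have lu p q : l p - u q <= d^-1 * mdist p q.
  have pq0 : 0 <= d^-1 * mdist p q by rewrite mulr_ge0 ?mdist_ge0// invr_ge0 ltW.
  have tp := t1 p; have tq := t1 q; have tpq := tLd p q.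
  rewrite /l /u; case: (asboolP (A1 p)) => [Ap|_]; case: (asboolP (A2 q)) => [Aq|_] //.
  - case: asboolP => [[Bq|/tO tq0]|_]; last by lra.
      by have := dM _ _ (AB _ _ Ap Bq); lra.
    by move: tpq; rewrite tq0.
  - case: asboolP => [[Bp|/tO tp0]|_]; last by lra.
      by have := dM _ _ (BA _ _ Bp Aq); lra.
    by move: tpq; rewrite tp0.
  - by case: asboolP => _; case: asboolP => _; lra.
have [||||h [lhu hL]] := @lipschitz_between R Z d^-1 l u.
- by rewrite invr_ge0 ltW.
- by move=> p; case/andP: (l1 p).
- by move=> p; case/andP: (u1 p).
- exact: lu.
have l0 s : ~ A1 s -> B1 s \/ O s -> 0 <= h s.
  by move=> nA BO; have /andP[+ _] := lhu s; rewrite /l asboolF// asboolT.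
have u0 s : ~ A2 s -> B2 s \/ O s -> h s <= 0.
  by move=> nA BO; have /andP[_ +] := lhu s; rewrite /u asboolF// asboolT.
have lt s : A1 s -> t s <= h s.
  by move=> A; have /andP[+ _] := lhu s; rewrite /l asboolT.
have ut s : A2 s -> h s <= t s.
  by move=> A; have /andP[_ +] := lhu s; rewrite /u asboolT.
have hO s : O s -> h s = 0.
  move=> Os; apply/eqP; rewrite eq_le; apply/andP; split.
    have [/ut|nA] := pselect (A2 s); first by rewrite (tO s Os).
    by apply: u0 => //; right.
  have [/lt|nA] := pselect (A1 s); first by rewrite (tO s Os).
  by apply: l0 => //; right.
exists h; split => //; split => //.
- by move=> p; have := lhu p; have := l1 p; have := u1 p; lra.
- apply: subset_trans (closure_subset (B := cball point e^-1) _) _.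
    move=> p /= hp; rewrite /cball/= leNgt; apply/negP => /hO hp0.
    by rewrite hp0 eqxx in hp.
  apply: subset_trans (@closed_cball _ _ _ _) _ => p; rewrite /cball/=.
  by move=> /le_trans; apply.
Qed.

Lemma pointed_isometry_inj (X Z : pmetricType R) (f : X -> Z) :
  pointed_isometry f -> injective f.
Proof.
by move=> [_ fI] p q fpq; apply: mdist_positivity; rewrite -fI fpq mdistxx.
Qed.

(** The bounds [3 / 4 * e <= d] and [e <= 3^-1] yield (2d)^-1 + 2d <= 1/e, the room that the nets
    need. *)
Lemma compact_pieces (d e : R) (X Y : pmms R) (Z : pmetricType R)
    (f : X -> Z) (g : Y -> Z) :
  pointed_isometry f -> pointed_isometry g ->
  0 < d -> d < e -> 3 / 4 * e <= d -> e <= 3^-1 ->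
  (FLr point (push (pmms_measure X) f) (push (pmms_measure Y) g) d^-1 d^-1 < d%:E)%E ->
  exists (K : set X) (cK : compact K) (xK : K point)
         (L : set Y) (cL : compact L) (yL : L point),
    [/\ supported_in_ball e K, supported_in_ball e L, small_complements e K L
      & d_pmGH (restr cK xK) (restr cL yL) < 3 * e].
Proof.
move=> fI gI d0 de d34 e3 Fd.
have e0 : 0 < e by lra.
have FXY := FLr_lt_integ fI gI Fd.
have FYX h : test_functions point d^-1 d^-1 h -> integ (h \o g) - integ (h \o f) < d.
  move=> th; have hb := test_bounded_bsupp th.
  have := FXY _ (test_functionsN th).
  rewrite [integ (_ \o f)](integN (bounded_bsupp_comp fI hb)).
  by rewrite [integ (_ \o g)](integN (bounded_bsupp_comp gI hb)); lra.
(* Each compact approximation loses less than [eta], and [d + 2 * eta] is still below [e]. *)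
pose r := e^-1; pose eta := (e - d) / 4.
have eta0 : 0 < eta by rewrite divr_gt0// subr_gt0.
have rd : r < d^-1 by rewrite ltf_pV2.
(* So that a point of spt nu at distance less than 2d from B(x,1/(2d)) is
   still in B(y,1/e). *)
have dr : (2 * d)^-1 + 2 * d <= r.
  have d32 : (2 * d)^-1 <= 2 / 3 * r.
    rewrite -[2 / 3]invf_div /r -invfM lef_pV2 ?posrE; lra.
  have e9 : 2 * d <= 2 / 9 * r.
    rewrite /r; apply: (@le_trans _ _ (2 * e)); first lra.
    by rewrite ler_pdivlMr//; nra.
  have : 0 < r by rewrite invr_gt0.
  lra.
pose NX := near_support f g d; pose NY := near_support g f d.
have clX : closed NX := closed_near_support (g := g) fI (d := d).
have clY : closed NY := closed_near_support (g := f) gI (d := d).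
pose GX := spt (pmms_measure X) `&` cball point r `&` NX.
pose GY := spt (pmms_measure Y) `&` cball point r `&` NY.
have core (V : pmms R) (N : set V) : closed N ->
    exists K0, [/\ compact K0, K0 `<=` spt (pmms_measure V) `&` cball point r `&` N &
    fine (pmms_measure V (spt (pmms_measure V) `&` cball point r `&` N `\` K0)) < eta].
  move=> cN; set G := _ `&` N.
  have cG : closed G.
    by apply: closedI => //; apply: closedI; [exact: closed_spt|exact: closed_cball].
  have Gfin : (pmms_measure V G < +oo)%E.
    apply: le_lt_trans (pmms_locfin point r); apply: le_measure.
    - by apply/mem_set; exact: borel_closed.
    - by apply/mem_set; apply: borel_closed; exact: closed_cball.
    - by move=> p [[]].
  have [K0 [cK0 K0G K0e]] := compact_approximation cG Gfin eta0.
  exists K0; split => //; rewrite -lte_fin fineK//; apply: fin_real.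
  by rewrite (lt_le_trans _ (measure_ge0 _ _))//= (lt_trans K0e)// ltry.
have [K0 [cK0 K0G K0e]] := core X NX clX.
have [L0 [cL0 L0G L0e]] := core Y NY clY.
have K0N : K0 `<=` NX by move=> p /K0G[].
have L0N : L0 `<=` NY by move=> p /L0G[].
(* Each net lies in the other space: [FL] in [Y] serves [K0], and [FK] in [X] serves [L0]. *)
have [FL [fFL FLs FLK FLp]] := finite_net fI gI d0 cK0 K0N dr rd.
have [FK [fFK FKs FKL FKp]] := finite_net gI fI d0 cL0 L0N dr rd.
pose K := K0 `|` FK `|` [set point]; pose L := L0 `|` FL `|` [set point].
have cK : compact K.
  by apply: compactU; [apply: compactU => //; exact: finite_compact|exact: compact_set1].
have cL : compact L.
  by apply: compactU; [apply: compactU => //; exact: finite_compact|exact: compact_set1].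
have xK : K point by right.
have yL : L point by right.
have r0 : 0 < r by rewrite invr_gt0.
have pr (V : pmetricType R) : cball (point : V) r point.
  by rewrite /cball/= mdistxx ltW.
have Ks : K `<=` (spt (pmms_measure X) `|` [set point]) `&` cball point r.
  move=> p [[/K0G[[]]|/FKs[]]|->]; [by split; [left|]|by split; [left|]|].
  by split; [right|exact: pr].
have Ls : L `<=` (spt (pmms_measure Y) `|` [set point]) `&` cball point r.
  move=> p [[/L0G[[]]|/FLs[]]|->]; [by split; [left|]|by split; [left|]|].
  by split; [right|exact: pr].
exists K, cK, xK, L, cL, yL; split => //.
  have lte (V : pmms R) (M : set V) :
      (pmms_measure V (cball point r `\` M) < (d + eta)%:E)%E ->
      (pmms_measure V (cball point e^-1 `\` M) < e%:E)%E.
    by move=> /lt_le_trans; apply; rewrite lee_fin /eta; lra.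
  rewrite /small_complements gt_max; apply/andP; split; apply: lte.
    apply: (fine_complement_lt (K0 := K0) (G := NX)) => //.
    - by apply: borel_closed; exact: closed_compact.
    - by move=> p K0p; left; left.
    - exact: measure_far_lt.
  apply: (fine_complement_lt (K0 := L0) (G := NY)) => //.
  - by apply: borel_closed; exact: closed_compact.
  - by move=> p L0p; left; left.
  - exact: measure_far_lt.
have IK := pointed_isometry_val xK; have IL := pointed_isometry_val yL.
pose fK : pointed_sub xK -> Z := f \o set_val.
pose gL : pointed_sub yL -> Z := g \o set_val.
have fKI : pointed_isometry fK.
  by split => [|p q]; [exact: (proj1 fI)|rewrite [LHS](proj2 fI)].
have gLI : pointed_isometry gL.
  by split => [|p q]; [exact: (proj1 gI)|rewrite [LHS](proj2 gI)].
apply: le_lt_trans (@d_pmGH_le R (restr cK xK) (restr cL yL) Z fK gL fKI gLI) _.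
have de3 : 2 * d + e < 3 * e by lra.
have d20 : 0 < 2 * d by rewrite mulr_gt0.
have near (V W : pmms R) (M : set V) (N : set W) (v : V -> Z) (w : W -> Z) :
    pointed_isometry v ->
    (forall p, M p -> mdist point p <= (2 * d)^-1 ->
      exists2 q, N q & mdist (v p) (w q) < 2 * d) ->
    forall a, (range (v \o (set_val : M -> V)) `&` cball point (2 * d)^-1) a ->
      (edist_inf (range (w \o (set_val : N -> W))) a <= (2 * d)%:E)%E.
  move=> vI h a [[p _ <-]]; rewrite /cball/= -{1}(proj1 vI) (proj2 vI) => pz.
  have [q Nq pq] := h _ (set_valP p) pz.
  apply: (@le_trans _ _ (edist (v (set_val p), w q))).
    apply: ereal_inf_lbound; exists (w q) => //.
    by exists (exist _ q (mem_set Nq)).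
  by apply: edist_fin => //=; rewrite ballEmdist.
(* Core points have partners in the net of the other space, net points in the other core, and the
   base points coincide in [Z]. *)
have H2 : Hdist point (range fK) (range gL) <= 2 * d.
  apply: inf_half_le => //; split.
    apply: near => // p [[K0p|FKp']|->] pz.
    - by have [q Fq pq] := FLK p K0p pz; exists q => //; left; right.
    - by have [q Lq pq] := FKp p FKp'; exists q; [left; left|rewrite metric_sym].
    - by exists point => //; rewrite (proj1 fI) (proj1 gI) mdistxx.
  apply: near => // p [[L0p|FLp']|->] pz.
  - by have [q Fq pq] := FKL p L0p pz; exists q => //; left; right.
  - by have [q Kq pq] := FLp p FLp'; exists q; [left; left|rewrite metric_sym].
  - by exists point => //; rewrite (proj1 fI) (proj1 gI) mdistxx.
suff Fe : Fdist point (push (pmms_measure (restr cK xK)) fK)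
  (push (pmms_measure (restr cL yL)) gL) <= e.
  exact: le_lt_trans (lerD H2 Fe) de3.
apply: inf_half_le => //.
apply: (@le_lt_trans _ _ (d + 2 * eta)%:E); last by rewrite lte_fin /eta; lra.
apply: (@FLr_le R (restr cK xK) (restr cL yL) Z fK gL fKI gLI) => t tt.
have tb := test_bounded_bsupp tt.
have tfb := bounded_bsupp_comp fI tb; have tgb := bounded_bsupp_comp gI tb.
rewrite (_ : t \o fK = (t \o f) \o set_val)// (_ : t \o gL = (t \o g) \o set_val)//.
rewrite (integ_restr cK xK tfb) (integ_restr cL yL tgb).
(* The base point may lie outside the support, and only support points are known to be at distance
   [d] from the other discarded part. *)
pose A1 := f @` (K `&` spt (pmms_measure X)).
pose A2 := g @` (L `&` spt (pmms_measure Y)).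
pose B1 := f @` (~` NX); pose B2 := g @` (~` NY).
have [||h [th hA1 hA2 hB1 hB2]] := @modified_test Z t d e A1 A2 B1 B2 d0 (ltW de) tt.
- move=> _ _ [p [_ sp] <-] [q nq <-]; rewrite metric_sym.
  by apply: (not_near_support nq); left; exists p.
- move=> _ _ [p np <-] [q [_ sq] <-].
  by apply: (not_near_support np); left; exists q.
have hb := test_bounded_bsupp th.
have hfb := bounded_bsupp_comp fI hb; have hgb := bounded_bsupp_comp gI hb.
have h1 s : -1 <= h s <= 1 by case: th.
have mG (V : pmms R) (N M : set V) : closed N -> compact M ->
    measurable (spt (pmms_measure V) `&` cball point r `&` N `\` M : set (borel V)).
  move=> cN cM; apply: measurableD; last by apply: borel_closed; exact: closed_compact.
  apply: borel_closed; apply: closedI => //; apply: closedI; first exact: closed_spt.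
  exact: closed_cball.
have leX : integ ((t \o f) \_ K) <= integ (h \o f) + fine (pmms_measure X (GX `\` K0)).
  apply: (integ_restrict_le (r := r)) => //; first exact: mG.
  - by move=> p [[[]]].
  - by move=> p /=; case/andP: (h1 (f p)).
  - by move=> p sp Kp; apply: hA1; exists p.
  (* A support point outside [K] and [GX \ K0] is outside the ball or not in [NX], so [h] is
     nonnegative at its image. *)
  move=> p sp nKp nN; apply: hB1.
    by move=> [q [Kq _] /(pointed_isometry_inj fI) qp]; apply: nKp; rewrite -qp.
  rewrite -(proj1 fI) (proj2 fI); have [?|pz] := ltP r (mdist point p); first by right.
  left; exists p => // Np; apply: nN; split => // K0p.
  by apply: nKp; left; left.
(* With signs reversed the same estimate bounds the integral over [L] from below. *)
have leY : integ ((fun q => - (t \o g) q) \_ L) <=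
    integ (fun q => - (h \o g) q) + fine (pmms_measure Y (GY `\` L0)).
  apply: (integ_restrict_le (r := r)) => //; first exact: mG.
  - by move=> p [[[]]].
  - exact: bounded_bsuppN.
  - exact: bounded_bsuppN.
  - by move=> p /=; rewrite lerN2; case/andP: (h1 (g p)).
  - by move=> p sp Lp; rewrite lerN2; apply: hA2; exists p.
  move=> p sp nLp nN; rewrite oppr_ge0; apply: hB2.
    by move=> [q [Lq _] /(pointed_isometry_inj gI) qp]; apply: nLp; rewrite -qp.
  rewrite -(proj1 gI) (proj2 gI); have [?|pz] := ltP r (mdist point p); first by right.
  left; exists p => // Np; apply: nN; split => // L0p.
  by apply: nLp; left; left.
have oppL : (fun q => - (t \o g) q) \_ L = (fun q => - ((t \o g) \_ L) q).
  by apply/funext => q; rewrite !patchE; case: ifP => // _; rewrite oppr0.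
move: leY; rewrite oppL !integN//; last first.
  apply: bounded_bsupp_restrict => //; apply: borel_closed; exact: closed_compact.
by have := FXY h th; rewrite -/GX in K0e; rewrite -/GY in L0e; lra.
Qed.

(** Here [3 * e > 1] and [d_pmGH] is at most 1, so the two spaces can be approximated
    independently. *)
Lemma compact_pieces_trivial (e : R) (X Y : pmms R) : 0 < e -> 3^-1 < e ->
  exists (K : set X) (cK : compact K) (xK : K point)
         (L : set Y) (cL : compact L) (yL : L point),
    [/\ supported_in_ball e K, supported_in_ball e L, small_complements e K L
      & d_pmGH (restr cK xK) (restr cL yL) < 3 * e].
Proof.
move=> e0 e3.
have piece (V : pmms R) : exists M : set V,
    [/\ compact M, M point, supported_in_ball e M &
      (pmms_measure V (cball point e^-1 `\` M) < e%:E)%E].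
  pose G := spt (pmms_measure V) `&` cball point e^-1.
  have cB : closed (cball (point : V) e^-1) by exact: closed_cball.
  have cG : closed G by apply: closedI => //; exact: closed_spt.
  have mB := borel_closed cB; have mG := borel_closed cG.
  have Gfin : (pmms_measure V G < +oo)%E.
    apply: le_lt_trans (pmms_locfin point e^-1); apply: le_measure => //.
    - exact: mem_set.
    - exact: mem_set.
    - by move=> p [].
  have [M [cM MG Me]] := compact_approximation cG Gfin e0.
  have mM : measurable (M : set (borel V)) by apply: borel_closed; exact: closed_compact.
  have cM' : compact (M `|` [set point]) by apply: compactU => //; exact: compact_set1.
  exists (M `|` [set point]); split => //; first by right.
    move=> p [/MG[sp pe]|->]; split => //; [by left|by right|].
    by rewrite /cball/= mdistxx invr_ge0 ltW.
  apply: le_lt_trans Me.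
  have mN : measurable (~` spt (pmms_measure V) : set (borel V)).
    by apply: measurableC; apply: borel_closed; exact: closed_spt.
  have mGM : measurable (G `\` M : set (borel V)) by exact: measurableD.
  rewrite -[leRHS]add0e -(spt_compl_null V).
  apply: le_trans (measureU2 _ mN mGM); apply: le_measure.
  - apply/mem_set; apply: measurableD => //; apply: borel_closed; exact: closed_compact.
  - by apply/mem_set; exact: measurableU.
  move=> p [pe nM]; have [sp|] := pselect (spt (pmms_measure V) p); last by left.
  by right; split => // Mp; apply: nM; left.
have [K [cK xK Ks Ke]] := piece X; have [L [cL yL Ls Le]] := piece Y.
exists K, cK, xK, L, cL, yL; split => //.
  by rewrite /small_complements gt_max Ke.
by apply: le_lt_trans (d_pmGH_le1 _ _) _; lra.
Qed.

End Compact_pieces.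

(** * The forward direction at every scale, and the bi-Lipschitz equivalence *)

Lemma d_star_compact_pieces (R : realType) (e : R) (X Y : pmms R) :
  0 < e -> d_star X Y < e ->
  exists (K : set X) (cK : compact K) (xK : K point)
         (L : set Y) (cL : compact L) (yL : L point),
    [/\ supported_in_ball e K, supported_in_ball e L, small_complements e K L
      & d_pmGH (restr cK xK) (restr cL yL) < 3 * e].
Proof.
move=> e0 de; have [e3|e3] := leP e 3^-1; last exact: compact_pieces_trivial.
have [Z [f [g [fI gI]]]] := d_star_lt de.
move=> /inf_half_lt[|d [d0 de' Fd]]; first lra.
(* Raising [d] leaves fewer test functions and a weaker bound, so the hypothesis survives while
   [3 / 4 * e <= d'] is gained. *)
pose d' := Num.max d (3 / 4 * e).
have dd' : d <= d' by rewrite le_max lexx.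
have dd'V : d'^-1 <= d^-1 by rewrite lef_pV2// posrE (lt_le_trans d0).
apply: (compact_pieces (d := d') fI gI) => //.
- exact: lt_le_trans dd'.
- by rewrite gt_max de'; lra.
- by rewrite le_max lexx orbT.
- apply: (@lt_le_trans _ _ d%:E); last by rewrite lee_fin.
  apply: le_lt_trans Fd; apply: le_ereal_sup; apply: image_subset.
  exact: test_functions_mono.
Qed.

Theorem theorem4p11 (R : realType) :
  (forall (e : R) (X Y : pmms R), 0 < e ->
    (d_star X Y < e ->
      exists (K : set X) (cK : compact K) (xK : K point)
             (L : set Y) (cL : compact L) (yL : L point),
        [/\ supported_in_ball e K, supported_in_ball e L, small_complements e K L
          & d_pmGH (restr cK xK) (restr cL yL) < 3 * e])
    /\
    (forall (K : set X) (cK : compact K) (xK : K point)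
            (L : set Y) (cL : compact L) (yL : L point),
      supported_in_ball e K -> supported_in_ball e L -> small_complements e K L ->
      d_star (restr cK xK) (restr cL yL) < e ->
      d_star X Y < 3 * e))
  /\
  (exists2 C : R, 0 < C &
    forall X Y : pmms R,
      d_star X Y <= C * d_compact X Y /\ d_compact X Y <= C * d_star X Y).
Proof.
split=> [e X Y e0|].
  split; first exact: d_star_compact_pieces.
  by move=> K cK xK L cL yL _ _; exact: d_star_lt_of_restr.
(* [d_compact < d] gives [d_star < 3d] between the compact pieces, and then the
   converse at scale [3d] applies. *)
exists 9 => // X Y; split.
  have [c2|c2] := ltP (d_compact X Y) 2^-1; last first.
    by apply: le_trans (d_star_le_half X Y) _; move: c2; lra.
  have c0 : 0 <= d_compact X Y by exact: inf_half_ge0.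
  rewrite -ler_pdivrMl//; apply/ler_addgt0Pr => eta eta0.
  rewrite ler_pdivrMl//.
  have : d_compact X Y < Num.min (d_compact X Y + eta) 2^-1.
    by rewrite lt_min c2 andbT ltrDl.
  move=> /inf_half_lt[|d [d0 dm [K [cK [xK [L [cL [yL [_ _ sKL dKL]]]]]]]]].
    by rewrite ge_min lexx orbT.
  (* Tripling the scale shrinks the balls and relaxes the bound. *)
  have sKL3 : small_complements (3 * d) K L.
    have d3 : d <= 3 * d by lra.
    have d3V : (3 * d)^-1 <= d^-1 by rewrite lef_pV2// posrE; lra.
    have mono (V : pmms R) (M : set V) : compact M ->
        (pmms_measure V (cball point d^-1 `\` M) < d%:E)%E ->
        (pmms_measure V (cball point (3 * d)^-1 `\` M) < (3 * d)%:E)%E.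
      move=> /closed_compact/borel_closed mM Md.
      apply: (@lt_le_trans _ _ d%:E); last by rewrite lee_fin.
      apply: le_lt_trans Md; apply: le_measure.
      - by apply/mem_set; apply: measurableD => //; apply: borel_closed; exact: closed_cball.
      - by apply/mem_set; apply: measurableD => //; apply: borel_closed; exact: closed_cball.
      by apply: setSD => p; rewrite /cball/= => /le_trans; apply.
    move: sKL; rewrite /small_complements !gt_max => /andP[Kd Ld].
    by rewrite !mono.
  have : d_star X Y < 3 * (3 * d).
    apply: (d_star_lt_of_restr (cK := cK) (xK := xK) (cL := cL) (yL := yL)) => //.
      by rewrite mulr_gt0.
    exact: le_lt_trans (d_star_le_d_pmGH _ _) dKL.
  by move: dm; rewrite lt_min => /andP[]; lra.
have s0 := d_star_ge0 X Y.
(* This inequality holds with constant 1: by the forward direction every [e] above [d_star X Y] is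
   admissible. *)
suff : d_compact X Y <= d_star X Y by lra.
apply/ler_addgt0Pr => eta eta0.
have e0 : 0 < d_star X Y + eta by lra.
apply: inf_half_le => //; apply: d_star_compact_pieces => //.
by rewrite ltrDl.
Qed.
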